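(* For every $\varepsilon>0$ there exist constants $c_4(\varepsilon)\ge1$ and $c_5>0$ ($c_5$ not depending on $\varepsilon$) such that for all $N\ge c_4(\varepsilon)$ there is $c(\varepsilon,N)$ such that for all $d\ge c(\varepsilon,N)$, \[ \mathbb{P}\big[0\stackrel{\ge h_{\mathrm{as}}(d)(1+\varepsilon)}{\longleftrightarrow}S_1(0,Nd)\big]\le\exp\{-c_5\,f(\varepsilon,N)\,d\log d\}, \] where $f(\varepsilon,N)=\varepsilon^3\sqrt{N/(1+\varepsilon)}$.
   Context: Under $\mathbb{P}$, $\varphi=(\varphi_x)_{x\in\mathbb{Z}^d}$ is the Gaussian free field on $\mathbb{Z}^d$ ($d\ge3$), centered Gaussian with covariance given by the Green function $g(x,y)=\sum_{n\ge0}P_x[X_n=y]$ of simple random walk; $h_{\mathrm{as}}(d)=\sqrt{2g(0,0)\log d}$. $S_1(0,r)=\{y\in\mathbb{Z}^d:|y|_1=r\}$. For $h\in\mathbb{R}$ and $A,B\subset\mathbb{Z}^d$, $\{A\stackrel{\ge h}{\longleftrightarrow}B\}$ is the event that there is a nearest-neighbour path of vertices $x$ with $\varphi_x\ge h$ connecting $A$ and $B$. *)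

(* Defs.v *)
From HB Require Import structures.
From mathcomp Require Import all_boot all_order all_algebra.
From mathcomp Require Import all_classical all_reals all_analysis.
From mathcomp Require Import normal_distribution.
Set Implicit Arguments. Unset Strict Implicit. Unset Printing Implicit Defensive.
Import Order.TTheory GRing.Theory Num.Theory.
Local Open Scope classical_set_scope.
Local Open Scope ring_scope.

Definition Zd (d : nat) := 'I_d -> int.

Definition origin (d : nat) : Zd d := fun _ => 0%Z.
Arguments origin d : clear implicits.

Definition pt_eqb d (x y : Zd d) : bool := [forall i, x i == y i].

Definition shift d (x : Zd d) (i : 'I_d) (s : int) : Zd d :=
  fun j => if j == i then (x j + s)%R else x j.

Definition l1 d (x : Zd d) : nat := (\sum_(i < d) `|x i|%N)%N.

Definition adjacent d (x y : Zd d) : Prop :=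
  l1 (fun i => (x i - y i)%R) = 1%N.

Definition sphere1 d (r : nat) : set (Zd d) := [set y | l1 y = r].
Arguments sphere1 d r : clear implicits.

(** n-step transition probability P_x[X_n = y] of simple random walk on Z^d,
    via the first-step decomposition. *)
Fixpoint srw_prob {R : realType} d (n : nat) : Zd d -> Zd d -> R :=
  match n with
  | 0%N => fun x y => if pt_eqb x y then 1 else 0
  | n'.+1 => fun x y => (2 * d%:R)^-1 *
      \sum_(i < d) (srw_prob n' (shift x i 1) y + srw_prob n' (shift x i (-1)) y)
  end.

(** Green function g(x,y) = sum_{n>=0} P_x[X_n = y] (series of nonnegative
    terms summed in the extended reals; finite for d >= 3). *)
Definition green {R : realType} d (x y : Zd d) : R :=
  fine (\sum_(0 <= n <oo) (srw_prob n x y)%:E)%E.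

Definition h_as {R : realType} (d : nat) : R :=
  Num.sqrt (2 * green (origin d) (origin d) * ln d%:R).

(** phi is a centered Gaussian field on Z^d with covariance the Green function:
    each phi_x is measurable and every finite linear combination
    sum_i a_i phi_{x_i} is N(0, sum_{i,j} a_i a_j g(x_i,x_j)) (degenerate
    Gaussian = a.s. 0 when the variance vanishes). *)
Definition is_GFF {R : realType} (d : nat) (dT : measure_display)
  (T : measurableType dT) (P : probability T R) (phi : Zd d -> T -> R) : Prop :=
  (forall x, measurable_fun setT (phi x)) /\
  (forall (n : nat) (xs : 'I_n -> Zd d) (a : 'I_n -> R),
     let Y := fun t => \sum_(i < n) a i * phi (xs i) t in
     let v := \sum_(i < n) \sum_(j < n) a i * a j * green (xs i) (xs j) in
     (0 < v -> forall B : set R, measurable B ->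
        P (Y @^-1` B) = normal_prob 0 (Num.sqrt v) B) /\
     (v = 0 -> P [set t | Y t = 0] = 1%E)).

Definition connects_above {R : realType} d (T : Type) (phi : Zd d -> T -> R)
  (h : R) (B : set (Zd d)) : set T :=
  [set t | exists (k : nat) (p : nat -> Zd d),
     pt_eqb (p 0%N) (origin d) /\ B (p k) /\
     (forall i, (i < k)%N -> adjacent (p i) (p i.+1)) /\
     (forall i, (i <= k)%N -> h <= phi (p i) t)].

Definition f_eps_N {R : realType} (eps N : R) : R :=
  eps ^+ 3 * Num.sqrt (N / (1 + eps)).

(* Main.v *)
Require Import Defs.
From HB Require Import structures.
From mathcomp Require Import all_boot all_order all_algebra.
From mathcomp Require Import all_classical all_reals all_analysis.
From mathcomp Require Import normal_distribution.
From mathcomp Require Import measurable_realfun.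
From mathcomp Require Import ring lra zify.
Import Order.TTheory GRing.Theory Num.Theory.
(* mathcomp-analysis has its own [shift]; make [Defs.shift] visible again. *)
Import Defs.
Local Open Scope classical_set_scope.
Local Open Scope ring_scope.

Set Implicit Arguments. Unset Strict Implicit.

(** A shortest path in the level set from [0] to the sphere is an induced path,
    and its first [m = N d] vertices are determined by [m] steps, so there are
    at most [(2 d) ^ m] candidates. On such a candidate the sum of the field is
    a centered Gaussian of variance [m (1 + O(N / d))], hence exceeds
    [m (1 + eps) h_as] with probability at most
    [exp (- m (1 + eps) ^ 2 (1 - o(1)) ln d)], which beats the entropy and leaves
    [exp (- eps N d ln d)]. This is stronger than required once
    [1 + eps ^ 4 <= N].

    The variance bound needs [g (x, y)] to be at most [1 + O(1/d)] on the
    diagonal, [O(1/d)] for neighbours and [O(1/d^2)] otherwise. It follows by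
    comparing [g] with the explicit superharmonic function equal to
    [288 / (d ^ 2 (|x|_2 ^ 2 + 7))], plus [1 + 1/d] at the origin and [1/d]
    at its neighbours. *)

(** * Lattice points, unit shifts and the l1 norm *)

Section lattice.
Context {d : nat}.
Implicit Types (x y : Zd d) (i : 'I_d) (s : int).

Definition vsub x y : Zd d := fun i => x i - y i.

Lemma pt_eqbP x y : reflect (x = y) (pt_eqb x y).
Proof.
apply: (iffP forallP) => [h|-> i //]; apply/funext => i; exact/eqP/h.
Qed.

Lemma vsub_shift x y i s : vsub (shift x i s) y = shift (vsub x y) i s.
Proof. by apply/funext => j; rewrite /vsub /shift; case: ifP => _ //; ring. Qed.

Lemma l1_shift x i s :
  l1 x = (`|x i| + \sum_(j < d | j != i) `|x j|)%N /\
  l1 (shift x i s) = (`|(x i + s)%R| + \sum_(j < d | j != i) `|x j|)%N.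
Proof.
rewrite /l1 !(bigD1 i (P := xpredT)) //=; split => //.
rewrite /shift eqxx; congr addn; apply: eq_bigr => j /negPf -> //.
Qed.

Lemma l1_vsub_eq0 x y : l1 (vsub x y) = 0%N -> x = y.
Proof.
move=> /eqP; rewrite sum_nat_eq0 => /forallP h; apply/funext => i.
by have := h i; rewrite /vsub /= => /eqP; lia.
Qed.

Lemma adjacent_shift x y : adjacent x y ->
  exists i (b : bool), y = shift x i (if b then 1 else -1).
Proof.
rewrite /adjacent /l1 => /eqP/sum_nat_eq1[i [_ h1 h]].
exists i, (x i < y i); apply/funext => j; rewrite /shift.
case: eqP => [->|/eqP ji].
  by case: ltP; lia.
by have := h j ji isT; lia.
Qed.

End lattice.

(** * The Green function and its superharmonic majorant *)

Section green.
Context {R : realType} {d : nat}.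
Implicit Types (x y : Zd d) (i : 'I_d) (u : Zd d -> R).

Definition srw_step u x : R :=
  (2 * d%:R)^-1 * \sum_(i < d) (u (shift x i 1) + u (shift x i (-1))).

Lemma srw_step_le u v x : (forall x, u x <= v x) -> srw_step u x <= srw_step v x.
Proof.
move=> h; rewrite ler_wpM2l ?invr_ge0 ?mulr_ge0 //.
by apply: ler_sum => i _; rewrite lerD.
Qed.

Lemma srw_stepD u v x : srw_step (u \+ v) x = srw_step u x + srw_step v x.
Proof.
rewrite /srw_step -mulrDr -big_split /=; congr (_ * _).
by apply: eq_bigr => i _; rewrite addrACA.
Qed.

Lemma srw_prob_ge0 n x y : 0 <= srw_prob n x y :> R.
Proof.
elim: n x => [|n ih] x /=; first by case: ifP.
by rewrite mulr_ge0 ?invr_ge0 ?mulr_ge0 // sumr_ge0 // => i _; rewrite addr_ge0.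
Qed.

Lemma srw_prob_sumS m x y :
  \sum_(n < m.+1) srw_prob n x y =
  (pt_eqb x y)%:R + srw_step (fun z => \sum_(n < m) srw_prob n z y) x :> R.
Proof.
rewrite big_ord_recl /=; congr (_ + _); first by case: ifP.
rewrite -mulr_sumr exchange_big /=; congr (_ * _); apply: eq_bigr => i _.
by rewrite -big_split.
Qed.

(* Superharmonic comparison: the Green function is the least nonnegative
   solution of [u = delta_y + P u]. *)
Lemma green_bounds u y :
  (forall x, 0 <= u x) ->
  (forall x, (pt_eqb x y)%:R + srw_step u x <= u x) ->
  forall x, (pt_eqb x y)%:R <= (green x y : R) <= u x.
Proof.
move=> u0 hu x.
(* The sum over the first [m + 1] times is [delta_y] plus one averaging of the sum over the first
   [m], so [u] dominates every partial sum. *)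
have ps m : forall x, \sum_(n < m) srw_prob n x y <= u x.
  elim: m => [|m ih] z; first by rewrite big_ord0.
  rewrite srw_prob_sumS; apply: le_trans (hu z); rewrite lerD2l.
  exact: srw_step_le.
pose S := (\sum_(0 <= n <oo) (srw_prob n x y : R)%:E)%E.
have p0 n : (0 <= n)%N -> xpredT n -> (0 <= (srw_prob n x y : R)%:E)%E.
  by move=> _ _; rewrite lee_fin srw_prob_ge0.
have S1 : ((pt_eqb x y)%:R%:E <= S)%E.
  by have := nneseries_lim_ge 1 p0; rewrite big_nat1 /= -/S; case: ifP.
have Su : (S <= (u x)%:E)%E.
  apply: lime_le; first exact: is_cvg_nneseries.
  by apply: nearW => m; rewrite sumEFin lee_fin big_mkord.
(* Finiteness must be settled before leaving the extended reals, since [fine] turns infinity into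
   [0]. *)
have Sf : S \is a fin_num.
  rewrite fin_numElt (le_lt_trans Su) ?ltry // andbT.
  by apply: lt_le_trans S1; rewrite ltNyr.
by rewrite /green -/S -!lee_fin fineK // S1 Su.
Qed.

Definition sqnorm x : R := \sum_(i < d) (x i)%:~R ^+ 2.

Lemma sqnorm_ge0 x : 0 <= sqnorm x.
Proof. by apply: sumr_ge0 => i _; rewrite sqr_ge0. Qed.

Lemma sqr_le_sqnorm x i : (x i)%:~R ^+ 2 <= sqnorm x.
Proof.
rewrite /sqnorm (bigD1 i) //= lerDl; apply: sumr_ge0 => j _; exact: sqr_ge0.
Qed.

Lemma sqnorm_shift x i s :
  sqnorm (shift x i s) = sqnorm x + 2 * s%:~R * (x i)%:~R + s%:~R ^+ 2.
Proof.
rewrite /sqnorm !(bigD1 i (P := xpredT)) //= /shift eqxx rmorphD /=.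
under eq_bigr => j /negPf ji do rewrite ji.
ring.
Qed.

Lemma sqnorm_le_l1 x : sqnorm x <= (l1 x)%:R ^+ 2.
Proof.
rewrite expr2 {2}/l1 natr_sum mulr_sumr; apply: ler_sum => i _.
rewrite -real_normK ?num_real // -intr_norm -abszE expr2.
by rewrite -!pmulrn -natr_sum ler_wpM2r ?ler0n // ler_nat (bigD1 i) //= leq_addr.
Qed.

Definition far_part x : R := (sqnorm x + 7)^-1.

(** With [s = sqnorm x + 8], [a = x i] and [u = 4 a^2 / s^2], the left side is [(2 / s) / (1 - u)].
    Now [1 / (1 - u) <= 1 + 2 u] for [0 <= u <= 1/2], and [u <= 1/2] because [a^2 <= sqnorm x]. *)
Lemma far_part_pair x i : far_part (shift x i 1) + far_part (shift x i (-1)) <=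
  2 / (sqnorm x + 8) + 16 * (x i)%:~R ^+ 2 / (sqnorm x + 8) ^+ 3.
Proof.
rewrite /far_part !sqnorm_shift; have := sqr_le_sqnorm x i.
set a : R := (x i)%:~R; set r := sqnorm x => ar.
have r0 : 0 <= r := sqnorm_ge0 x.
have h1 : 0 < r + 8 + 2 * a by nra.
have h2 : 0 < r + 8 - 2 * a by nra.
have h3 : 0 < r + 8 by lra.
have -> : r + 2 * 1%:~R * a + 1%:~R ^+ 2 + 7 = r + 8 + 2 * a by ring.
have -> : r + 2 * (- 1)%:~R * a + (- 1)%:~R ^+ 2 + 7 = r + 8 - 2 * a by ring.
set s := r + 8 in h1 h2 h3 *.
have h4 : 8 * a ^+ 2 <= s ^+ 2 by rewrite /s; nra.
have -> : (s + 2 * a)^-1 + (s - 2 * a)^-1 = 2 * s / ((s + 2 * a) * (s - 2 * a)).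
  by field; rewrite !gt_eqF.
rewrite ler_pdivrMr ?mulr_gt0 // -subr_ge0.
have -> : (2 / s + 16 * a ^+ 2 / s ^+ 3) * ((s + 2 * a) * (s - 2 * a)) - 2 * s =
    8 * a ^+ 2 * (s ^+ 2 - 8 * a ^+ 2) / s ^+ 3.
  by field; rewrite gt_eqF.
apply: divr_ge0; last by rewrite exprn_ge0 // ltW.
by apply: mulr_ge0; [rewrite mulr_ge0 ?sqr_ge0|rewrite subr_ge0].
Qed.

(** With [r = sqnorm x], averaging the pair bounds gives [1/(r+8) + 8 r / (d (r+8)^3)], whose second
    term is at most [1 / (2 (r+8)^2)] for [16 <= d]. As [1/(r+7) - 1/(r+8) >= 1/(r+8)^2], half of
    this gap survives as the defect. *)
Lemma srw_step_far x : (16 <= d)%N ->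
  srw_step far_part x <= far_part x - (2 * (sqnorm x + 8) ^+ 2)^-1.
Proof.
move=> d16; have d0 : 16 <= d%:R :> R by rewrite ler_nat.
have r0 := sqnorm_ge0 x.
rewrite /srw_step mulrC ler_pdivrMr; last by lra.
apply: le_trans; first by apply: ler_sum => i _; exact: far_part_pair.
rewrite big_split /= sumr_const card_ord -mulr_suml -mulr_sumr -/(sqnorm x).
rewrite /far_part -[_ *+ d]mulr_natr -subr_ge0.
set r := sqnorm x in r0 *.
have -> : ((r + 7)^-1 - (2 * (r + 8) ^+ 2)^-1) * (2 * d%:R) -
    (2 / (r + 8) * d%:R + 16 * r / (r + 8) ^+ 3) =
    (d%:R * ((r + 8) * (r + 9)) - 16 * r * (r + 7)) / ((r + 7) * (r + 8) ^+ 3).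
  by field; apply/andP; split; rewrite gt_eqF; lra.
rewrite divr_ge0 //; last by rewrite mulr_ge0 ?exprn_ge0 //; lra.
rewrite subr_ge0; apply: (@le_trans _ _ (16 * ((r + 8) * (r + 9)))); first by nra.
by rewrite ler_wpM2r //; nra.
Qed.

(** Along a nonzero coordinate one neighbour is farther from the origin and one closer; along a zero
    coordinate both are farther. At most [l1 x] coordinates are nonzero, each adding at least 1 to
    the norm. *)
Lemma srw_step_l1 (psi : nat -> R) x : (0 < d)%N -> (forall n, 0 <= psi n) ->
  srw_step (fun z => psi (l1 z)) x <=
    psi (l1 x).+1 + (l1 x)%:R / (2 * d%:R) * psi (l1 x).-1.
Proof.
move=> d0 psi0; have dr : 0 < 2 * d%:R :> R by rewrite mulr_gt0 ?ltr0n.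
rewrite /srw_step mulrC ler_pdivrMr // mulrDl mulrAC divfK ?gt_eqF //.
apply: (@le_trans _ _ (\sum_(i < d)
    (psi (l1 x).+1 *+ 2 + `|x i|%N%:R * psi (l1 x).-1))); last first.
  rewrite big_split /= sumr_const card_ord -mulr_suml -natr_sum -/(l1 x).
  rewrite -(mulr_natr _ d) -(mulr_natr _ 2); lra.
apply: ler_sum => i _.
have [e e1] := l1_shift x i 1; have [_ e2] := l1_shift x i (-1).
have [x0|x0] := eqVneq (x i) 0.
  have -> : l1 (shift x i 1) = (l1 x).+1 by rewrite e1 e x0.
  have -> : l1 (shift x i (-1)) = (l1 x).+1 by rewrite e2 e x0.
  by rewrite x0 mul0r addr0 mulr2n.
have k : psi (l1 (shift x i 1)) + psi (l1 (shift x i (-1))) =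
    psi (l1 x).+1 + psi (l1 x).-1.
  rewrite e1 e2 e; case: (ltP (x i) 0) => xi; first rewrite addrC;
  by congr (psi _ + psi _); lia.
rewrite k lerD // ?mulr2n ?lerDl // ler_peMl // ler1n; lia.
Qed.

Definition near_part (n : nat) : R :=
  match n with 0 => 1 + d%:R^-1 | 1 => d%:R^-1 | _ => 0 end.

(* The constant 288 = 2 * 12 ^ 2 makes the superharmonicity defect of
   [288 / d ^ 2 * far_part] at l1-distance 2 equal to what [near_part], cut off there,
   leaves uncompensated. *)
Definition green_ub x : R := near_part (l1 x) + 288 / d%:R ^+ 2 * far_part x.

Lemma srw_stepZ c u x : srw_step (fun z => c * u z) x = c * srw_step u x.
Proof.
rewrite /srw_step mulrCA; congr (_ * _); rewrite mulr_sumr.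
by apply: eq_bigr => i _; rewrite mulrDr.
Qed.

Lemma near_part_ge0 n : 0 <= near_part n.
Proof. by case: n => [|[|n]] //=; rewrite ?addr_ge0 ?invr_ge0. Qed.

Lemma far_part_ge0 x : 0 <= far_part x.
Proof. by rewrite invr_ge0 addr_ge0 ?sqnorm_ge0. Qed.

Lemma green_ub_supersolution x : (16 <= d)%N ->
  (l1 x == 0%N)%:R + srw_step green_ub x <= green_ub x.
Proof.
move=> d16; have d0 : 16 <= d%:R :> R by rewrite ler_nat.
have e0 : 0 <= 288 / d%:R ^+ 2 :> R by rewrite divr_ge0 ?exprn_ge0.
have := srw_step_l1 (psi := near_part) x (@ltn_trans 15 0 d isT d16) near_part_ge0.
have := srw_step_far x d16.
rewrite (_ : green_ub = (fun z => near_part (l1 z)) \+ (fun z => 288 / d%:R ^+ 2 * far_part z)) //.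
rewrite srw_stepD srw_stepZ /=; move: (srw_step _ _) (srw_step _ _) => F N hF hN.
have s0 := sqnorm_ge0 x; have s1 := sqnorm_le_l1 x.
have hG : 0 < (2 * (sqnorm x + 8) ^+ 2)^-1.
  by rewrite invr_gt0 mulr_gt0 ?exprn_gt0 //; lra.
have hF' := ler_wpM2l e0 hF.
have hG0 := mulr_ge0 e0 (ltW hG).
have di : d%:R * d%:R^-1 = 1 :> R by rewrite divff // gt_eqF //; lra.
have i0 : 0 < d%:R^-1 :> R by rewrite invr_gt0; lra.
(* At the origin the source [1] and the neighbours' [1/d] use up [near_part 0]. At distance 1 the
   average [(1 + 1/d) / (2 d)] is at most [1/d]. At distance 2 the average [1/d^2] is paid by the
   far defect, where [sqnorm x <= 4]. Farther out the near part contributes nothing. *)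
case E : (l1 x) s1 hN => [|[|[|n]]] s1 /= hN.
- by lra.
- move: hN; rewrite invfM mul1r => hN; nra.
- suff : 2%:R / (2 * d%:R) * d%:R^-1 <= 288 / d%:R ^+ 2 * (2 * (sqnorm x + 8) ^+ 2)^-1 by lra.
  have -> : 2%:R / (2 * d%:R) * d%:R^-1 = 288 / d%:R ^+ 2 * 288^-1 :> R.
    by field; rewrite gt_eqF //; lra.
  by rewrite ler_wpM2l // lef_pV2 ?posrE //; nra.
- by rewrite mulr0 in hN; lra.
Qed.

(** Shifts commute with subtracting [y], so the estimate with pole at the origin carries over to the
    pole [y]. *)
Lemma green_ub_vsub_supersolution x y : (16 <= d)%N ->
  (pt_eqb x y)%:R + srw_step (fun z => green_ub (vsub z y)) x <= green_ub (vsub x y).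
Proof.
move=> d16; apply: le_trans (green_ub_supersolution (vsub x y) d16).
apply: lerD.
  case: pt_eqbP => // ->; rewrite ler1n; suff -> : l1 (vsub y y) = 0%N by [].
  by rewrite /l1 big1 // => i _; rewrite /vsub subrr.
by rewrite /srw_step; under eq_bigr do rewrite !vsub_shift.
Qed.

Lemma green_le x y : (16 <= d)%N ->
  (pt_eqb x y)%:R <= (green x y : R) <= near_part (l1 (vsub x y)) + 42 / d%:R ^+ 2.
Proof.
move=> d16; have d0 : 16 <= d%:R :> R by rewrite ler_nat.
have ub0 z : 0 <= green_ub (vsub z y).
  by rewrite /green_ub addr_ge0 ?near_part_ge0 ?mulr_ge0 ?divr_ge0 ?exprn_ge0 ?far_part_ge0.
have /(_ x)/andP[-> /le_trans ->] // := green_bounds ub0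
  (fun z => green_ub_vsub_supersolution z y d16).
rewrite /green_ub lerD2l.
(* [far_part] is at most [1/7], and [288 / 7 <= 42]. *)
apply: (@le_trans _ _ (288 / d%:R ^+ 2 * 7^-1)).
  rewrite ler_wpM2l ?divr_ge0 ?exprn_ge0 // lef_pV2 ?posrE //; have := sqnorm_ge0 (vsub x y); lra.
rewrite mulrAC ler_wpM2r ?invr_ge0 ?exprn_ge0 //; lra.
Qed.
End green.
Arguments near_part {R} d n.

(** * Gaussian tail and union bound *)

(** For [x >= t >= 0] one has [x^2 >= t^2 + (x - t)^2], so the density of mean 0 is at most the
    claimed factor times the density of mean [t], which has total mass 1. *)
Lemma normal_prob_tail (R : realType) (s t : R) : 0 < s -> 0 <= t ->
  (normal_prob 0 s `[t, +oo[%classic <= (expR (- t ^+ 2 / (s ^+ 2 *+ 2)))%:E)%E.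
Proof.
move=> s0 t0; set e := expR _.
have sN0 : s != 0 by rewrite gt_eqF.
have mI : measurable (`[t, +oo[%classic : set R) by exact: measurable_itv.
have mp m : measurable_fun `[t, +oo[%classic (EFin \o normal_pdf m s).
  by apply/measurable_EFinP; apply: measurable_funTS; exact: measurable_normal_pdf.
apply: (@le_trans _ _ (e%:E * normal_prob t s `[t, +oo[%classic)%E); last first.
  rewrite -[leRHS]mule1 lee_pmul2l ?lte_fin ?expR_gt0 //; exact: probability_le1.
rewrite /normal_prob -ge0_integralZl //=.
- apply: ge0_le_integral => //=.
  + by move=> x _; rewrite lee_fin normal_pdf_ge0.
  + exact: mp.
  + apply: (measurable_funeM (f := EFin \o normal_pdf t s)); exact: mp.
  + move=> x; rewrite in_itv /= andbT => tx;rewrite -EFinM lee_fin.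
    rewrite !normal_pdfE // mulrCA ler_wpM2l ?normal_peak_ge0 //.
    rewrite /normal_fun /e -expRD ler_expR -mulrDl ler_wpM2r //.
      by rewrite invr_ge0 mulrn_wge0 ?sqr_ge0.
    nra.
- exact: mp.
- by move=> x _; rewrite lee_fin normal_pdf_ge0.
- by rewrite lee_fin expR_ge0.
Qed.

Lemma finite_union_bound (d : measure_display) (T : measurableType d) (R : realType)
    (P : probability T R) (I : finType) (Q : pred I) (A : I -> set T) (a : R) :
  0 <= a -> (forall i, Q i -> measurable (A i)) -> (forall i, Q i -> (P (A i) <= a%:E)%E) ->
  (P (\big[setU/set0]_(i | Q i) A i) <= (#|I|%:R * a)%:E)%E.
Proof.
move=> a0 mA hA.
have : (P (\big[setU/set0]_(i | Q i) A i) <= \sum_(i : I | Q i) a%:E)%E.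
  have [_] : measurable (\big[setU/set0]_(i | Q i) A i) /\
      (P (\big[setU/set0]_(i | Q i) A i) <= \sum_(i : I | Q i) a%:E)%E; last by [].
  apply: (big_ind2 (fun B (b : \bar R) => measurable B /\ (P B <= b)%E)).
  - by rewrite measure0.
  - move=> B b C c [mB hB] [mC hC]; split; first exact: measurableU.
    apply: le_trans (leeD hB hC); exact: measureU2.
  - by move=> i Qi; split; [exact: mA|exact: hA].
move=> /le_trans; apply.
by rewrite sumEFin lee_fin (sumr_const Q) mulr_natl ler_wpMn2l ?max_card.
Qed.

(** * Words of steps and shortest paths *)

Section paths.
Context {d : nat}.
Implicit Types (x y : Zd d) (p : nat -> Zd d) (w : seq ('I_d * bool)).

(** Coding a path by its steps (axis and sign) makes the paths with [m] steps a finite type with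
    [(2 d) ^ m] elements, and all finite paths a countable one. *)
Definition walk w (i : nat) : Zd d :=
  foldl (fun x s => shift x s.1 (if s.2 then 1 else -1)) (origin d) (take i w).

Lemma walk_rcons w s i : (i <= size w)%N -> walk (rcons w s) i = walk w i.
Proof. by move=> iw; rewrite /walk -cats1 takel_cat. Qed.

Lemma walk_rconsS w s : walk (rcons w s) (size w).+1 =
  shift (walk w (size w)) s.1 (if s.2 then 1 else -1).
Proof.
by rewrite /walk take_oversize ?size_rcons // foldl_rcons take_size.
Qed.

Lemma adjacent_shiftE x i (b : bool) : adjacent x (shift x i (if b then 1 else -1)).
Proof.
rewrite /adjacent /l1 (bigD1 i) //= big1 /shift ?eqxx.
  by case: b; lia.
by move=> j /negPf ->; rewrite subrr.
Qed.

Lemma adjacent_walk w i : (i < size w)%N -> adjacent (walk w i) (walk w i.+1).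
Proof.
elim/last_ind: w => // w s ih; rewrite size_rcons ltnS leq_eqVlt => /predU1P[->|iw].
  by rewrite walk_rconsS walk_rcons //; exact: adjacent_shiftE.
by rewrite !walk_rcons ?(ltnW iw) //; exact: ih.
Qed.

Lemma path_walk p k : p 0%N = origin d ->
  (forall i, (i < k)%N -> adjacent (p i) (p i.+1)) ->
  exists2 w, size w = k & forall i, (i <= k)%N -> walk w i = p i.
Proof.
move=> p0; elim: k => [|k ih] adj.
  by exists [::] => // i; rewrite leqn0 => /eqP ->; rewrite p0.
have [i ik|w wk wp] := ih; first by apply: adj; rewrite ltnW.
have [i [b e]] := adjacent_shift (adj k (ltnSn k)).
exists (rcons w (i, b)); first by rewrite size_rcons wk.
move=> j; rewrite leq_eqVlt => /predU1P[->|]; last first.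
  by rewrite ltnS => jk; rewrite walk_rcons ?wk // wp.
by rewrite -wk walk_rconsS wk wp.
Qed.

Lemma l1_le_path p k : p 0%N = origin d ->
  (forall i, (i < k)%N -> adjacent (p i) (p i.+1)) -> (l1 (p k) <= k)%N.
Proof.
move=> p0; elim: k => [|k ih] adj; first by rewrite p0 /l1 big1.
have : adjacent (p k) (p k.+1) by exact: adj.
have : (l1 (p k) <= k)%N by apply: ih => i ik; apply: adj; rewrite ltnW.
rewrite /adjacent /l1.
move: (p k) (p k.+1) => x y; rewrite -ltnS => h e.
have : (\sum_i `|y i| <= \sum_i (`|(x i - y i)%R| + `|x i|))%N.
  by apply: leq_sum => i _; lia.
by rewrite big_split /= e add1n => /leq_trans; apply.
Qed.

(** In a path of minimal length a repeated vertex or a chord would allow a shortcut inside the same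
    set [Q]. *)
Lemma shortest_path (Q B : set (Zd d)) p k : p 0%N = origin d -> B (p k) ->
  (forall i, (i < k)%N -> adjacent (p i) (p i.+1)) ->
  (forall i, (i <= k)%N -> Q (p i)) ->
  exists k p, [/\ p 0%N = origin d, B (p k),
    forall i, (i < k)%N -> adjacent (p i) (p i.+1),
    forall i, (i <= k)%N -> Q (p i) &
    forall i j, (i < j <= k)%N ->
      p i <> p j /\ (adjacent (p i) (p j) -> j = i.+1)].
Proof.
pose good k := `[< exists p, [/\ p 0%N = origin d, B (p k),
    forall i, (i < k)%N -> adjacent (p i) (p i.+1) &
    forall i, (i <= k)%N -> Q (p i)] >].
move=> p0 pk padj pQ.
have gk : exists k, good k by exists k; apply/asboolP; exists p.
case: (ex_minnP gk) => {p0 pk padj pQ}n /asboolP[{}p [p0 pn adj pQ]] nmin.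
(* Deleting the [c] vertices after [p i] contradicts minimality. The rest must be rejoined by an
   edge from [p i], or, if nothing remains, [p i] must itself be the endpoint. *)
have shortcut i c : (0 < c)%N -> (i + c <= n)%N ->
    ((i + c < n)%N -> adjacent (p i) (p (i + c).+1)) ->
    ((i + c)%N = n -> p i = p n) -> False.
  move=> c0 icn h1 h2.
  suff /nmin : good (n - c)%N by lia.
  apply/asboolP; exists (fun m => if (m <= i)%N then p m else p (m + c)%N); split.
  - by [].
  - case: leqP => ni; last by rewrite subnK //; lia.
    by rewrite (_ : n - c = i)%N ?h2 //; lia.
  - move=> m mn; have [mi|mi|mi] := ltngtP m i.
    + by apply: adj; lia.
    + by apply: adj; lia.
    + by rewrite mi addSn; apply: h1; lia.
  - by move=> m mn; case: ifP => mi; apply: pQ; lia.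
exists n, p; split => // i j /andP[ij jn]; split.
  (* A repetition: the whole loop from [i] to [j] is removed. *)
  move=> e; apply: (shortcut i (j - i)%N); rewrite ?(subnKC (ltnW ij)) //; first lia.
    by move=> jn'; rewrite e; exact: adj.
  by move=> <-.
move=> a; apply/eqP; rewrite eqn_leq ij andbT leqNgt; apply/negP => ij'.
(* A chord: only the vertices strictly between [i] and [j] are removed. *)
apply: (shortcut i (j - i.+1)%N); try lia.
by move=> _; rewrite -addSn subnKC.
Qed.

End paths.

(** The event is a countable union, over words of steps, of finite intersections of level events. *)
Lemma measurable_connects_above (R : realType) d (dT : measure_display)
    (T : measurableType dT) (phi : Zd d -> T -> R) (h : R) (B : set (Zd d)) :
  (forall x, measurable_fun setT (phi x)) -> measurable (connects_above phi h B).
Proof.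
move=> mphi.
have -> : connects_above phi h B = \bigcup_(w : seq ('I_d * bool))
    [set t | B (walk w (size w)) /\ forall i, (i <= size w)%N -> h <= phi (walk w i) t].
  apply/seteqP; split => t /=.
    move=> [k [p [/pt_eqbP p0 [pB [adj ph]]]]].
    have [w wk wp] := path_walk p0 adj.
    exists w => //=; rewrite wk wp //; split => // i ik; rewrite wp //; exact: ph.
  move=> [w _ /= [wB wh]]; exists (size w), (walk w); split; last split => //.
    by apply/pt_eqbP; rewrite /walk take0.
  by split => // i; exact: adjacent_walk.
apply: countable_bigcupT_measurable => // w.
have [wB|wB] := pselect (B (walk w (size w))); last first.
  by rewrite (_ : mkset _ = set0) //; apply/seteqP; split => t //= -[].
rewrite (_ : mkset _ = \bigcap_(i < (size w).+1) [set t | h <= phi (walk w i) t]).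
  apply: fin_bigcap_measurable => [|i _]; first exact: finite_II.
  have := mphi (walk w i) measurableT _ (measurable_itv `[h, +oo[).
  rewrite setTI; congr measurable; apply/seteqP; split => t /=;
  by rewrite in_itv /= andbT.
by apply/seteqP; split => t /=; [move=> [_ wh] i /= iw; exact: wh|move=> wh].
Qed.

(** * Variance of the field summed along an induced path *)

Lemma sum_eq_le1 (R : realType) m c : \sum_(j < m) ((j : nat) == c)%:R <= 1 :> R.
Proof.
case: (ltnP c m) => cm; last first.
  by rewrite big1 // => j _; rewrite ltn_eqF // (leq_trans _ cm).
rewrite (bigD1 (Ordinal cm)) //= eqxx big1 ?addr0 // => j.
by rewrite -val_eqE /= => /negPf ->.
Qed.

Section variance.
Context {R : realType} {d m : nat}.
Implicit Types xs : 'I_m -> Zd d.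

Definition induced_path xs := forall i j : 'I_m, (i < j)%N ->
  xs i <> xs j /\ (adjacent (xs i) (xs j) -> j = i.+1 :> nat).

Lemma l1_vsub_sym x y : l1 (vsub x y : Zd d) = l1 (vsub y x).
Proof. by apply: eq_bigr => i _; rewrite /vsub; lia. Qed.

(** Only [j = i] gives distance 0 and only consecutive indices give distance 1. For [i = 0] the
    predecessor [i.-1] is again 0, which just adds a nonnegative term. *)
Lemma near_part_induced xs i j : induced_path xs ->
  near_part d (l1 (vsub (xs i) (xs j))) <=
    (1 + d%:R^-1) * ((j : nat) == i)%:R + d%:R^-1 * ((j : nat) == i.+1)%:R
     + d%:R^-1 * ((j : nat) == i.-1)%:R :> R.
Proof.
move=> ind; have di : 0 <= d%:R^-1 :> R by rewrite invr_ge0.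
case: (ltngtP i j) => ij /=.
- have [ne adj] := ind _ _ ij.
  case E : (l1 _) => [|[|n]] /=; last by rewrite !addr_ge0 // mulr_ge0.
    by case: ne; exact: l1_vsub_eq0.
  rewrite -(adj E) eqxx mulr0 mulr1 add0r lerDl mulr_ge0 //.
- have [ne adj] := ind _ _ ij; rewrite l1_vsub_sym.
  case E : (l1 _) => [|[|n]] /=; last by rewrite !addr_ge0 // mulr_ge0.
    by case: ne; exact: l1_vsub_eq0.
  by rewrite (adj E) /= eqxx mulr0 mulr1 add0r lerDr mulr_ge0 //.
- have -> : j = i by exact: val_inj.
  have -> : l1 (vsub (xs i) (xs i)) = 0%N by rewrite /l1 big1 // => k _; rewrite /vsub subrr.
  by rewrite /= mulr1 -addrA lerDl addr_ge0 // mulr_ge0.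
Qed.

(** Below, only the diagonal terms are kept, each at least 1. Above, a row has one diagonal term, at
    most two neighbours costing [1/d] each, and [m] remainders [42 / d^2]. *)
Lemma variance_bounds xs : (16 <= d)%N -> induced_path xs ->
  m%:R <= \sum_(i < m) \sum_(j < m) 1 * 1 * (green (xs i) (xs j) : R) <=
  m%:R * (1 + 3 / d%:R + 42 * m%:R / d%:R ^+ 2).
Proof.
move=> d16 ind; have di : 0 <= d%:R^-1 :> R by rewrite invr_ge0.
apply/andP; split.
  rewrite -[leLHS]mul1r mulr_natr -[X in _ *+ X]card_ord -sumr_const.
  apply: ler_sum => i _; rewrite (bigD1 i) //= !mul1r.
  have g0 (x y : Zd d) : (pt_eqb x y)%:R <= (green x y : R).
    by case/andP: (green_le (R := R) x y d16).
  rewrite -[leLHS]addr0 lerD //.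
    by apply: le_trans (g0 _ _); have /pt_eqbP -> : xs i = xs i by [].
  by apply: sumr_ge0 => j _; rewrite !mul1r; apply: le_trans (g0 _ _).
rewrite mulr_natl -[X in _ *+ X]card_ord -sumr_const; apply: ler_sum => i _.
apply: (@le_trans _ _ (\sum_(j < m) ((1 + d%:R^-1) * ((j : nat) == i)%:R +
    d%:R^-1 * ((j : nat) == i.+1)%:R + d%:R^-1 * ((j : nat) == i.-1)%:R +
    42 / d%:R ^+ 2))).
  apply: ler_sum => j _; rewrite !mul1r.
  have /andP[_ /le_trans] := green_le (R := R) (xs i) (xs j) d16; apply.
  by rewrite lerD2r; exact: near_part_induced.
rewrite !big_split /= -!mulr_sumr sumr_const card_ord -[_ *+ m]mulr_natr.
have h c := sum_eq_le1 R m c.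
have h1 := ler_wpM2l di (h i.+1); have h2 := ler_wpM2l di (h i.-1).
have h3 : (1 + d%:R^-1) * \sum_(j < m) ((j : nat) == i)%:R <= (1 + d%:R^-1) * 1 :> R.
  by rewrite ler_wpM2l ?addr_ge0.
lra.
Qed.
End variance.

(** * Tails of path sums and the union over paths *)

(** The lower variance bound puts the sum in the nondegenerate Gaussian case; the upper one enters
    the tail exponent [(m h)^2 / (2 v)]. *)
Lemma path_sum_tail (R : realType) d (dT : measure_display) (T : measurableType dT)
    (P : probability T R) (phi : Zd d -> T -> R) m (xs : 'I_m -> Zd d) (h : R) :
  is_GFF P phi -> (16 <= d)%N -> (0 < m)%N -> 0 <= h -> induced_path xs ->
  let A := [set t | m%:R * h <= \sum_(i < m) phi (xs i) t] in
  measurable A /\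
  (P A <= (expR (- (m%:R * h ^+ 2 /
                    (2 * (1 + 3 / d%:R + 42 * m%:R / d%:R ^+ 2)))))%:E)%E.
Proof.
move=> [mphi gff] d16 m0 h0 ind A.
have [+ _] := gff m xs (fun=> 1); have := variance_bounds (R := R) d16 ind.
set v := \sum_(i < m) _; set k := 1 + _ + _ => /andP[mv vk].
have mr : 0 < m%:R :> R by rewrite ltr0n.
have v0 : 0 < v by exact: lt_le_trans mv.
move=> /(_ v0 _ (measurable_itv `[m%:R * h, +oo[)).
rewrite (_ : _ @^-1` _ = A); last first.
  have e t : \sum_(i < m) 1 * phi (xs i) t = \sum_(i < m) phi (xs i) t.
    by apply: eq_bigr => i _; rewrite mul1r.
  by apply/seteqP; split => t; rewrite /A /= in_itv /= andbT e.
move=> PA; split.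
  have : measurable_fun setT (fun t => \sum_(i < m) phi (xs i) t).
    by apply: measurable_sum => i; exact: mphi.
  move=> /(_ measurableT _ (measurable_itv `[m%:R * h, +oo[)); rewrite setTI.
  by congr measurable; apply/seteqP; split => t; rewrite /A /= in_itv /= andbT.
rewrite PA; apply: le_trans (normal_prob_tail _ _) _; rewrite ?sqrtr_gt0 ?mulr_ge0 //.
rewrite lee_fin ler_expR sqr_sqrtr ?(ltW v0) // mulNr lerN2.
have k0 : 0 < k by rewrite -(pmulr_rgt0 _ mr); exact: lt_le_trans vk.
have -> : m%:R * h ^+ 2 / (2 * k) = (m%:R * h) ^+ 2 / (2 * (m%:R * k)).
  by field; rewrite !gt_eqF.
by rewrite ler_wpM2l ?sqr_ge0 // lef_pV2 ?posrE ?mulr_gt0 ?pmulrn_lgt0 // -mulr_natl ler_wpM2l.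
Qed.

(** Reaching l1-norm [m] takes at least [m] steps, so the vertices [p 0, ..., p (m - 1)] of a
    shortest path exist and inherit the induced property. With [m] summands and [m] steps, energy
    and entropy carry the same factor [m]. *)
Lemma connects_above_sub (R : realType) d (T : Type) (phi : Zd d -> T -> R) h m :
  connects_above phi h (sphere1 d m) `<=`
  \big[setU/set0]_(w : m.-tuple ('I_d * bool) | `[< induced_path (fun i : 'I_m => walk w i) >])
    [set t | m%:R * h <= \sum_(i < m) phi (walk w i) t].
Proof.
move=> t [k [p [/pt_eqbP p0 [pk [adj ph]]]]].
have {k p p0 pk adj ph}[k [p [p0 pk adj ph ind]]] :=
  shortest_path (Q := [set x | h <= phi x t]) p0 pk adj ph.
have mk : (m <= k)%N by rewrite -[m]pk; exact: l1_le_path.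
have [w wm wp] : exists2 w : seq ('I_d * bool), size w = m &
    forall i, (i <= m)%N -> walk w i = p i.
  by apply: path_walk => // i im; apply: adj; exact: leq_trans mk.
pose wt : m.-tuple ('I_d * bool) := tcast wm (in_tuple w).
have wtE : wt = w :> seq _ by rewrite val_tcast.
rewrite (bigD1 wt) /=; last first.
  apply/asboolP => i j ij; rewrite wtE !wp 1?ltnW //.
  by apply: ind; rewrite ij (leq_trans (ltnW (ltn_ord j))).
left => /=; rewrite mulr_natl -[X in _ *+ X]card_ord -sumr_const.
apply: ler_sum => i _; rewrite wtE wp ?(ltnW (ltn_ord i)) //.
by apply: ph; rewrite (leq_trans (ltnW (ltn_ord i))).
Qed.

Lemma connects_above_le (R : realType) d (dT : measure_display) (T : measurableType dT)
    (P : probability T R) (phi : Zd d -> T -> R) m (h : R) :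
  is_GFF P phi -> (16 <= d)%N -> (0 < m)%N -> 0 <= h ->
  (P (connects_above phi h (sphere1 d m)) <=
    (expR (m%:R * ln (2 * d%:R) -
       m%:R * h ^+ 2 / (2 * (1 + 3 / d%:R + 42 * m%:R / d%:R ^+ 2))))%:E)%E.
Proof.
move=> gff d16 m0 h0.
pose Q (w : m.-tuple ('I_d * bool)) := `[< induced_path (fun i : 'I_m => walk w i) >].
pose A (w : m.-tuple ('I_d * bool)) := [set t | m%:R * h <= \sum_(i < m) phi (walk w i) t].
have tail w : Q w -> _ := fun Qw =>
  path_sum_tail gff d16 m0 h0 (asboolW Qw).
apply: (@le_trans _ _ (P (\big[setU/set0]_(w | Q w) A w))).
  apply: le_measure; rewrite ?inE.
  - by apply: measurable_connects_above; case: gff.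
  - by apply: bigsetU_measurable => w /tail[].
  - exact: connects_above_sub.
apply: le_trans.
  apply: finite_union_bound => [|w /tail[] //|w /tail[_ h1]]; last exact: h1.
  exact: expR_ge0.
(* The number of words, [(2 d) ^ m], becomes the entropy term [m ln (2 d)] of the exponent. *)
rewrite lee_fin card_tuple card_prod card_ord card_bool expRD ler_wpM2r ?expR_ge0 //.
by rewrite expRM_natl lnK ?posrE ?mulr_gt0 ?ltr0n ?(leq_trans _ d16) // natrX natrM mulrC.
Qed.

(** * Energy against entropy, and the choice of constants *)

(** Applied with [L = ln d], [l2 = ln 2], [delta = K / d]. Since [1 / (1 + delta) >= 1 - delta], the
    variance correction and [l2] cost at most [eps L / 2] each, out of the gain
    [(2 eps + eps^2) L]. *)
Lemma exponent_bound (R : realType) (eps delta L l2 : R) :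
  0 < eps -> 0 <= delta -> delta * (1 + eps) ^+ 2 <= eps / 2 ->
  l2 <= eps / 2 * L -> 0 < L ->
  l2 + L - (1 + eps) ^+ 2 * L / (1 + delta) <= - (eps * L).
Proof.
move=> e0 d0 hd hl L0.
have : (1 + eps) ^+ 2 * L * (1 - delta) <= (1 + eps) ^+ 2 * L / (1 + delta).
  rewrite ler_pdivlMr; last by lra.
  have h := mulr_ge0 (sqr_ge0 (1 + eps)) (ltW L0).
  have := mulr_ge0 h (sqr_ge0 delta); move: h; set c := _ * L => h h'.
  lra.
have := mulr_ge0 (ltW L0) (ltW e0).
set c := _ / _; nra.
Qed.

Lemma ln_h_as_sqr (R : realType) d : (16 <= d)%N ->
  2 * ln d%:R <= (h_as d : R) ^+ 2.
Proof.
move=> d16; rewrite /h_as.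
have L0 : 0 <= ln d%:R :> R by rewrite ln_ge0 // ler1n (leq_trans _ d16).
have /andP[g1 _] := green_le (R := R) (origin d) (origin d) d16.
have {}g1 : 1 <= green (origin d) (origin d) :> R.
  by apply: le_trans g1; have /pt_eqbP -> : origin d = origin d by [].
rewrite sqr_sqrtr ?mulr_ge0 //; last by lra.
by rewrite ler_wpM2r //; lra.
Qed.

(** One factor [eps] is split off; then [eps^2 <= sqrt N] and [sqrt (N / (1 + eps)) <= sqrt N]. *)
Lemma f_eps_N_le (R : realType) (eps N : R) : 0 < eps -> 1 + eps ^+ 4 <= N ->
  f_eps_N eps N <= eps * N.
Proof.
move=> e0 hN; rewrite /f_eps_N exprS -mulrA ler_pM2l //.
have N0 : 0 <= N by apply: le_trans hN; rewrite addr_ge0 // exprn_ge0 // ltW.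
rewrite -[leRHS]sqr_sqrtr // expr2.
apply: ler_pM; rewrite ?sqr_ge0 ?sqrtr_ge0 //.
  rewrite -[leLHS]ger0_norm ?sqr_ge0 // -sqrtr_sqr ler_wsqrtr //; lra.
by rewrite ler_wsqrtr // ler_pdivrMr ?ler_peMr //; lra.
Qed.

Theorem theorem3p5 (R : realType) :
  exists c5 : R, 0 < c5 /\
  forall eps : R, 0 < eps ->
  exists c4 : R, 1 <= c4 /\
  forall N : nat, c4 <= N%:R ->
  exists c : R,
  forall d : nat, (3 <= d)%N -> c <= d%:R ->
  forall (dT : measure_display) (T : measurableType dT) (P : probability T R)
         (phi : Zd d -> T -> R),
  is_GFF P phi ->
  (P (connects_above phi (h_as d * (1 + eps)) (sphere1 d (N * d)%N)) <=
    (expR (- (c5 * f_eps_N eps N%:R * d%:R * ln d%:R)))%:E)%E.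
Proof.
exists 1; split => // eps e0; exists (1 + eps ^+ 4); split.
  by rewrite lerDl exprn_ge0 // ltW.
(* For [m = N d] the variance correction [3 / d + 42 m / d^2] equals [K / d]. *)
move=> N hN; set K := 3 + 42 * N%:R : R.
have K0 : 0 < K by rewrite /K ltr_pwDl // mulr_ge0.
have N0 : (0 < N)%N.
  by rewrite -(ltr0n R); apply: lt_le_trans hN; rewrite ltr_pwDl // exprn_ge0 // ltW.
(* The summands serve, in order, the Green function bounds, [(K / d) (1 + eps)^2 <= eps / 2], and
   [ln 2 <= (eps / 2) ln d]. *)
exists (16 + 2 * K * (1 + eps) ^+ 2 / eps + expR (2 * ln 2 / eps)).
move=> d _ hd dT T P phi gff.
have x1 : 0 <= 2 * K * (1 + eps) ^+ 2 / eps.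
  by apply: divr_ge0; [apply: mulr_ge0; [lra|exact: sqr_ge0]|lra].
have x2 := expR_gt0 (2 * ln 2 / eps).
have d16r : 16 <= d%:R :> R by lra.
have d16 : (16 <= d)%N by rewrite -(ler_nat R).
have d0 : 0 < d%:R :> R by lra.
have L0 : 0 < ln d%:R :> R by rewrite ln_gt0 //; lra.
have hL : ln 2 <= eps / 2 * ln d%:R :> R.
  have : 2 * ln 2 / eps <= ln d%:R :> R.
    by rewrite -ler_expR lnK ?posrE //; lra.
  by rewrite ler_pdivrMr //; lra.
have hK : K / d%:R * (1 + eps) ^+ 2 <= eps / 2.
  rewrite mulrAC ler_pdivrMr //.
  have : 2 * K * (1 + eps) ^+ 2 / eps <= d%:R by lra.
  rewrite ler_pdivrMr //; lra.
have h1 := ln_h_as_sqr R d16.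
have h0 : 0 <= h_as d * (1 + eps) by rewrite mulr_ge0 ?sqrtr_ge0 //; lra.
have m0 : (0 < N * d)%N by rewrite muln_gt0 N0 (leq_trans _ d16).
have mr : 0 < (N * d)%:R :> R by rewrite ltr0n.
apply: le_trans (connects_above_le gff d16 m0 h0) _.
rewrite lee_fin ler_expR.
have -> : 1 + 3 / d%:R + 42 * (N * d)%:R / d%:R ^+ 2 = 1 + K / d%:R :> R.
  by rewrite /K natrM; field; rewrite gt_eqF.
have kd : 0 < K / d%:R by rewrite divr_gt0.
have := exponent_bound e0 (ltW kd) hK hL L0.
move=> /(ler_wpM2l (ltW mr)) h.
have hf := f_eps_N_le e0 hN.
apply: (@le_trans _ _ ((N * d)%:R * - (eps * ln d%:R))); last first.
  rewrite mul1r mulrN lerN2 natrM.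
  have := ler_wpM2r (ltW (mulr_gt0 d0 L0)) hf; lra.
apply: le_trans h.
(* After cancellation there remains [(1 + eps)^2 ln d <= (h_as (1 + eps))^2 / 2], which is where
   [g(0,0) >= 1] enters. *)
rewrite lnM ?posrE // -mulrA -mulrBr ler_wpM2l ?(ltW mr) // lerD2l lerN2.
have k1 : 0 < 1 + K / d%:R by lra.
rewrite exprMn invfM mulrA ler_wpM2r ?invr_ge0 ?(ltW k1) //.
have := ler_wpM2r (sqr_ge0 (1 + eps)) h1; lra.
Qed.
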